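(* Let $\mathcal S$ be a regular 2-spread in $\mathrm{PG}(5,q)$, and let $\mathbb S\subset\mathcal S$ be an exterior splash. In the cubic extension $\mathrm{PG}(5,q^3)$, there are exactly three transversals to $\mathbb S$ (lines meeting the extension of every plane of $\mathbb S$), namely the three transversals of $\mathcal S$. Hence $\mathbb S$ lies in a unique regular 2-spread, namely $\mathcal S$.
   Context: Let $q$ be a prime power, $\tau$ a primitive element of $\mathbb F_{q^3}$, and for $\alpha=a_0+a_1\tau+a_2\tau^2$ ($a_i\in\mathbb F_q$) write $[\alpha]=(a_0,a_1,a_2)$. A 2-spread of $\mathrm{PG}(5,q)$ is a set of $q^3+1$ planes partitioning the points. A 2-regulus is a set of $q+1$ mutually disjoint planes such that any line meeting three of them meets all of them. A 2-spread is regular if it contains the 2-regulus determined by any three of its planes. Embed $\mathrm{PG}(5,q)$ in $\mathrm{PG}(5,q^3)$. A regular 2-spread $\mathcal S$ has exactly three transversal lines in $\mathrm{PG}(5,q^3)$, i.e. lines meeting the extension of every plane of $\mathcal S$. These lines are skew, disjoint from $\mathrm{PG}(5,q)$, and of the form $g,g^q,g^{q^2}$ (conjugate under the Frobenius map). Bruck-Bose correspondence at infinity: let $\ell_\infty$ be the line $z=0$ of $\mathrm{PG}(2,q^3)$. A point $L=(\alpha,\beta,0)$ of $\ell_\infty$ corresponds to the plane $[L]=\{([\alpha x],[\beta x]): x\in\mathbb F_{q^3}\setminus\{0\}\}$ of $\mathrm{PG}(5,q)$. The set of all planes $[L]$ is a regular 2-spread $\mathcal S$, and every regular 2-spread of $\mathrm{PG}(5,q)$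 is projectively equivalent to it. An order-$q$-subplane $\pi$ of $\mathrm{PG}(2,q^3)$ is an image of $\mathrm{PG}(2,q)$ under $\mathrm{PGL}(3,q^3)$. If $\pi$ is exterior to $\ell_\infty$ (no point of $\pi$ on $\ell_\infty$), then its exterior splash is the set of $q^2+q+1$ points of $\ell_\infty$ lying on extended lines of $\pi$. The same term and symbol $\mathbb S$ are used for the corresponding set of $q^2+q+1$ planes of $\mathcal S$. *)

(* Defs.v *)
From HB Require Import structures.
From mathcomp Require Import all_boot all_order all_fingroup all_algebra.

Set Implicit Arguments.
Unset Strict Implicit.
Unset Printing Implicit Defensive.

Import GRing.Theory VectorInternalTheory.
Local Open Scope ring_scope.

(* Over a finite field, the subspaces of a vector space form a finite type. *)
HB.instance Definition _ (F : finFieldType) (vT : vectType F) :=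
  [Countable of {vspace vT} by <:].
HB.instance Definition _ (F : finFieldType) (vT : vectType F) :=
  [Finite of {vspace vT} by <:].

(* PG(n - 1, F) is the lattice of subspaces of 'rV[F]_n: points, lines and
   planes are the subspaces of (vector) dimension 1, 2 and 3. *)

Section Spreads.
Variable F : finFieldType.
Local Notation PG5 := {vspace 'rV[F]_6}.

Definition meets n (U V : {vspace 'rV[F]_n}) : bool := (U :&: V != 0)%VS.

Definition spread (S : {set PG5}) : Prop :=
  [/\ #|S| = (#|F| ^ 3 + 1)%N,
      forall U, U \in S -> \dim U = 3%N
    & forall P : PG5, \dim P = 1%N -> exists! U, U \in S /\ (P <= U)%VS].

Definition regulus (R : {set PG5}) : Prop :=
  [/\ #|R| = (#|F| + 1)%N,
      forall U, U \in R -> \dim U = 3%N,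
      forall U V, U \in R -> V \in R -> U != V -> ~~ meets U V
    & forall (l A B C : PG5), \dim l = 2%N ->
        A \in R -> B \in R -> C \in R -> uniq [:: A; B; C] ->
        meets l A -> meets l B -> meets l C ->
        forall U, U \in R -> meets l U].

(* Three mutually disjoint planes lie in exactly one regulus, the one that they
   determine, so that R below is unique. *)
Definition regular_spread (S : {set PG5}) : Prop :=
  spread S /\
  forall A B C, A \in S -> B \in S -> C \in S -> uniq [:: A; B; C] ->
    exists R, [/\ regulus R, [set A; B; C] \subset R & R \subset S].

End Spreads.

Section CubicExtension.
Variables (F K : finFieldType) (iota : {rmorphism F -> K}).

Definition extend n (U : {vspace 'rV[F]_n}) : {vspace 'rV[K]_n} :=
  <<[seq map_mx iota u | u in U]>>%VS.

Definition transversals (S : {set {vspace 'rV[F]_6}}) :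
    {set {vspace 'rV[K]_6}} :=
  [set l : {vspace 'rV[K]_6} |
    (\dim l == 2%N) && [forall U in S, meets l (extend U)]].

Definition points n : {set {vspace 'rV[K]_n}} :=
  [set P : {vspace 'rV[K]_n} | \dim P == 1%N].

(* The coordinates of a row v : 'rV_3 are (x, y, z) = (v 0 0, v 0 1, v 0 2). *)
Definition linfty : {vspace 'rV[K]_3} :=
  (<[delta_mx 0%R 0%R]> + <[delta_mx 0%R 1%R]>)%VS.

Definition subplane (pi : {set {vspace 'rV[K]_3}}) : Prop :=
  exists2 g : 'End('rV[K]_3), lker g = 0%VS &
    pi = [set (g @: extend P)%VS | P : {vspace 'rV[F]_3} & \dim P == 1%N].

Definition exterior (pi : {set {vspace 'rV[K]_3}}) : Prop :=
  forall P, P \in pi -> ~~ (P <= linfty)%VS.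

(* The extended lines of pi are the lines P + Q joining two of its points. *)
Definition splash (pi : {set {vspace 'rV[K]_3}}) : {set {vspace 'rV[K]_3}} :=
  [set X in points 3 | (X <= linfty)%VS &
    [exists P in pi, exists Q in pi, (P != Q) && (X <= P + Q)%VS]].

Variable tau : K.

(* [alpha] in the basis 1, tau, tau^2; the default 0 is only taken when these
   do not span K over F. *)
Definition coords (alpha : K) : 'rV[F]_3 :=
  odflt 0 [pick a : 'rV[F]_3 | \sum_(i < 3) iota (a 0 i) * tau ^+ i == alpha].

(* These vectors already form a subspace: it is their span. *)
Definition bb_plane (alpha beta : K) : {vspace 'rV[F]_6} :=
  <<[seq (row_mx (coords (alpha * x)%R) (coords (beta * x)%R) : 'rV[F]_6)
     | x : K]>>%VS.

(* The planes [L] for L in a set X of points of linfty; v runs over all the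
   homogeneous coordinates (alpha, beta, 0) of these points. *)
Definition bruck_bose (X : {set {vspace 'rV[K]_3}}) :
    {set {vspace 'rV[F]_6}} :=
  [set bb_plane (v 0 0) (v 0 1) | v : 'rV[K]_3 & <[v]>%VS \in X].

Definition bb_spread : {set {vspace 'rV[F]_6}} :=
  bruck_bose [set L in points 3 | (L <= linfty)%VS].

(* A regular spread S is identified with the points of linfty by a
   projectivity g that maps bb_spread to S. *)
Definition exterior_splash (S SS : {set {vspace 'rV[F]_6}}) : Prop :=
  exists g : 'End('rV[F]_6),
    [/\ lker g = 0%VS,
        S = [set (g @: U)%VS | U in bb_spread]
      & exists pi, [/\ subplane pi, exterior pi &
          SS = [set (g @: U)%VS | U in bruck_bose (splash pi)]]].

End CubicExtension.

(* Main.v *)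
Require Import Defs.
From HB Require Import structures.
From mathcomp Require Import all_boot all_order all_fingroup all_algebra.
From mathcomp Require Import finfield.
From mathcomp Require Import ring.

Set Implicit Arguments.
Unset Strict Implicit.
Unset Printing Implicit Defensive.

Import GRing.Theory.
Local Open Scope ring_scope.

(** Identify the vector space of PG(5,q) with K^2, by an F-linear bijection
theta given by two K-linear forms on K^6 (the columns of a matrix E), in such a
way that the planes of the regular spread S are the K-lines of K^2.  With
conjugates E_0, E_1, E_2 of E under the powers of the q-Frobenius, the map
z |-> (z E_0, z E_1, z E_2) is an isomorphism of K^6 with K^2 + K^2 + K^2, and
the extension of the plane of v lies in the sum of the lines K v^(q^i).  The
three summands K^2 are transversals of S.

The exterior splash is a linear set.  Let a be the linear form that cuts out
the line at infinity, in coordinates for which pi is PG(2,q).  The line f of pi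
meets infinity in the cross product f x a, so the splash consists of the planes
of f U for f in F^3, where the 3 x 2 matrix U has left kernel K a.  Exteriority
of pi says that the three coordinates of a are linearly independent over F.

A line meets the extension of the plane of v exactly when some nonzero vector
of it has, for each i, its i-th component proportional to v^(q^i).
Eliminating this vector gives, for each i != j, a sesquilinear form B_ij in
(v^(q^i), v^(q^j)) that vanishes on the splash.  The key lemma,
[splash_no_sesqui], says that such a form is zero: pulled back by U it becomes
an alternating 3 x 3 matrix whose kernel contains two different conjugates of
a, and these are not proportional since a is not proportional to a rational
vector.  The vanishing of all B_ij leaves only one nonzero component for the
line, so the line is one of the three summands ([splash_transversal]).

For the uniqueness of the spread, let S' be regular and contain the splash.
A regulus through the planes of v, w and v + w must consist of the plane of v
and the planes of w + c v with c in F ([regulus_plane]).  Hence the set of t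
such that the plane of v1 + t v0 is in S' contains the F-line through any two
of its points, and for q > 2 it is an F-subspace of K.  It has more than q^2
elements as the splash has q^2 + q + 1 planes ([card_splash]), so it is K.  For
q = 2 reguli give no information, but then the splash lacks only two planes of
S, and a subspace covered by two subspaces lies in one of them
([spread_eq_of_two_missing]). *)

(** * Powers of the Frobenius automorphism of a cubic extension *)

Section Frobenius.
Variables (F K : finFieldType) (iota : {rmorphism F -> K}).

(** The embedding of F occurs so that the ring morphism structure, which needs
F and K to have the same characteristic, can be attached to this function. *)
Definition frob of {rmorphism F -> K} := fun (i : nat) (x : K) => x ^+ (#|F| ^ i).

Fact frob_is_nmod_morphism i : nmod_morphism (frob iota i).
Proof.
have [p p_pr charFp] := finPcharP F.
have charKp : p \in [pchar K] by rewrite (fmorph_pchar iota).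
split=> [|x y]; first by rewrite /frob expr0n gtn_eqF // expn_gt0 (cardD1 0).
apply: exprDn_pchar.
rewrite (eq_pnat _ (pcharf_eq charKp)) (card_pprimeChar charFp).
by rewrite pnatX pnatX pnat_id.
Qed.

Fact frob_is_monoid_morphism i : monoid_morphism (frob iota i).
Proof. by split=> [|x y]; rewrite /frob ?expr1n ?exprMn. Qed.

HB.instance Definition _ i :=
  GRing.isNmodMorphism.Build K K (frob iota i) (frob_is_nmod_morphism i).
HB.instance Definition _ i :=
  GRing.isMonoidMorphism.Build K K (frob iota i) (frob_is_monoid_morphism i).

Lemma frob_iota i c : frob iota i (iota c) = iota c.
Proof.
rewrite /frob -rmorphXn; congr (iota _); elim: i => [|i IHi]; first exact: expr1.
by rewrite expnS exprM expf_card.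
Qed.

Lemma frob0 x : frob iota 0 x = x.
Proof. exact: expr1. Qed.

Lemma frobD i j x : frob iota i (frob iota j x) = frob iota (j + i) x.
Proof. by rewrite /frob -exprM expnD. Qed.

Lemma frob1_fixed x : frob iota 1 x = x -> exists c, x = iota c.
Proof.
rewrite /frob expn1 => fix_x.
have q_gt1 : (1 < #|F|)%N by apply: card_finNzRing_gt1.
set p : {poly K} := 'X^#|F| - 'X.
have size_p : size p = #|F|.+1.
  by rewrite size_polyDl size_polyXn // size_polyN size_polyX ltnS.
have p_neq0 : p != 0 by rewrite -size_poly_eq0 size_p.
case: (pickP (fun c => x == iota c)) => [c /eqP-> | notF]; first by exists c.
suff: (size (x :: [seq iota c | c <- enum F]) < size p)%N.
  by rewrite /= size_map -cardE size_p ltnn.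
apply: max_poly_roots p_neq0 _ _ => /=.
  rewrite rootE !hornerE fix_x subrr eqxx /=; apply/allP=> _ /mapP[c _ ->].
  by rewrite rootE !hornerE -rmorphXn /= expf_card subrr.
rewrite (map_inj_uniq (fmorph_inj iota)) enum_uniq andbT.
by apply/mapP=> -[c _ eq_x]; have:= notF c; rewrite eq_x eqxx.
Qed.

Hypothesis cardK : #|K| = (#|F| ^ 3)%N.

Lemma frob3 x : frob iota 3 x = x.
Proof. by rewrite /frob -cardK expf_card. Qed.

(** The quotient of two different powers of the Frobenius automorphism
generates the Galois group, which has order 3, so it fixes only F. *)
Lemma frob_eq (i j : 'I_3) x : i != j ->
  frob iota i x = frob iota j x -> exists c, x = iota c.
Proof.
wlog le_ij : i j / (i < j)%N => [hwlog neq_ij eq_x|].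
  have [/hwlog | | ] := ltngtP i j; first exact.
    by move/hwlog; apply; rewrite // eq_sym.
  by move/val_inj => eq_ij; rewrite eq_ij eqxx in neq_ij.
case: i j le_ij => [[|[|[|//]]] ?] [[|[|[|//]]] ?] //= _ _; rewrite ?frob0.
- by move/esym/frob1_fixed.
- by move/(congr1 (frob iota 1)); rewrite frobD frob3 => /frob1_fixed.
move/(congr1 (frob iota 2)); rewrite !frobD -[in RHS](frobD 1 3) frob3.
by move/esym/frob1_fixed.
Qed.

End Frobenius.

(** * The basis 1, tau, tau^2 *)

Section CubicBasis.
Variables (F K : finFieldType) (iota : {rmorphism F -> K}) (tau : K).
Hypothesis cardK : #|K| = (#|F| ^ 3)%N.

(** The Moore matrix of the basis 1, x, x^2, which is a Vandermonde matrix in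
the conjugates of x. *)
Definition moore (x : K) : 'M[K]_3 := Vandermonde 3 (\row_j frob iota j x).

Lemma moore_unit x : (forall c, x <> iota c) -> moore x \in unitmx.
Proof.
move=> x_notF; rewrite unitmxE unitfE det_Vandermonde.
apply/prodf_neq0 => i _; apply/prodf_neq0 => j ltij.
rewrite !mxE subr_eq0; have neq_ji : j != i by rewrite neq_ltn ltij orbT.
by apply/eqP=> /(frob_eq cardK neq_ji)[c /x_notF].
Qed.

Lemma primitive_notin :
  (#|F| ^ 3 - 1).-primitive_root tau -> forall c, tau <> iota c.
Proof.
move=> tau_prim c tauE.
have q_gt1 : (1 < #|F|)%N := card_finNzRing_gt1 F.
have q_gt0 := ltnW q_gt1.
have tau_neq0 : tau != 0.
  have := prim_expr_order tau_prim; apply: contra_eq_neq => ->.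
  by rewrite expr0n subn_eq0 leqNgt (@ltn_exp2l _ 0 3) //= eq_sym oner_eq0.
have : (#|F| ^ 3 - 1 %| #|F| - 1)%N.
  rewrite (prim_order_dvd tau_prim) tauE -rmorphXn /= subn1.
  have c_neq0 : c != 0 by rewrite -(fmorph_eq0 iota) -tauE.
  rewrite -(rmorph1 iota) (inj_eq (fmorph_inj iota)).
  by rewrite -(inj_eq (mulfI c_neq0)) mulr1 -exprS prednK // expf_card.
move/(dvdn_leq _); rewrite subn_gt0 leq_sub2rE // => /(_ q_gt1).
by rewrite -[X in (_ <= X)%N]expn1 leq_exp2l.
Qed.

Hypothesis tau_notin : forall c, tau <> iota c.

Definition powers : 'cV[K]_3 := \col_i tau ^+ i.

(** An F-linear relation between the powers of tau is also one between the
powers of each conjugate, hence between the rows of the Moore matrix. *)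
Lemma powers_free (a : 'rV[F]_3) : map_mx iota a *m powers = 0 -> a = 0.
Proof.
move=> a0; suff: map_mx iota a *m moore tau = 0.
  move/(congr1 (mulmxr (invmx (moore tau)))).
  rewrite /= mulmxK ?moore_unit // mul0mx => a0'.
  apply/rowP=> i; have /rowP/(_ i) := a0'.
  by rewrite !mxE => /eqP; rewrite fmorph_eq0 => /eqP.
apply/rowP=> j; have /rowP/(_ 0)/(congr1 (frob iota j)) := a0.
rewrite !mxE rmorph0 rmorph_sum => a0j; rewrite -[RHS]a0j; apply: eq_bigr => i _.
by rewrite !mxE rmorphM rmorphXn /= frob_iota.
Qed.

Lemma powers_inj (a b : 'rV[F]_3) :
  map_mx iota a *m powers = map_mx iota b *m powers -> a = b.
Proof.
move=> /eqP; rewrite -subr_eq0 -mulmxBl -map_mxB => /eqP/powers_free/eqP.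
by rewrite subr_eq0 => /eqP.
Qed.

Lemma coordsK x : map_mx iota (coords iota tau x) *m powers = x%:M.
Proof.
pose f (a : 'rV[F]_3) := (map_mx iota a *m powers) 0 0.
have f_inj : injective f.
  by move=> a b fab; apply: powers_inj; apply/rowP=> i; rewrite !ord1.
have /codomP[a xE] : x \in codom f.
  by apply: inj_card_onto f_inj _ x; rewrite cardK card_mx mul1n.
rewrite [LHS]mx11_scalar; congr (_%:M); rewrite /coords.
case: pickP => [b /eqP | /(_ a)/eqP[]] /=; rewrite xE /f !mxE.
  by move<-; apply: eq_bigr => i _; rewrite !mxE.
by apply: eq_bigr => i _; rewrite !mxE.
Qed.

End CubicBasis.

(** * The spread as the set of K-lines of a K-plane *)

Section Planes.
Variables (F K : finFieldType) (iota : {rmorphism F -> K}) (E : 'M[K]_(6, 2)).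

(** The linear map that views PG(5,q) as the projective line over K; all its
uses are for E such that it is injective, hence bijective. *)
Definition theta (u : 'rV[F]_6) : 'rV[K]_2 := map_mx iota u *m E.

Lemma thetaD u w : theta (u + w) = theta u + theta w.
Proof. by rewrite /theta map_mxD mulmxDl. Qed.

Lemma thetaZ c u : theta (c *: u) = iota c *: theta u.
Proof. by rewrite /theta map_mxZ scalemxAl. Qed.

Lemma thetaB u w : theta (u - w) = theta u - theta w.
Proof. by rewrite -scaleN1r thetaD thetaZ rmorphN1 scaleN1r. Qed.

Lemma theta0 : theta 0 = 0.
Proof. by rewrite /theta map_mx0 mul0mx. Qed.

Definition plane (v : 'rV[K]_2) : {vspace 'rV[F]_6} :=
  <<enum [pred u | theta u \in <[v]>%VS]>>%VS.

Lemma mem_plane v u : (u \in plane v) = (theta u \in <[v]>%VS).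
Proof.
apply/idP/idP=> [|uv]; last by apply: memv_span; rewrite mem_enum.
rewrite /plane; set X := enum _ => /(@coord_span _ _ _ (in_tuple X))->.
apply: (big_ind (fun w => theta w \in <[v]>%VS)) => [|w w' vw vw'|i _].
- by rewrite theta0 mem0v.
- by rewrite thetaD memvD.
rewrite thetaZ memvZ //=.
by have := mem_nth 0 (ltn_ord i); rewrite mem_enum.
Qed.

Lemma planeZ k v : k != 0 -> plane (k *: v) = plane v.
Proof.
move=> k_neq0; apply/vspaceP=> u; rewrite !mem_plane.
apply/vlineP/vlineP=> -[c ->]; first by exists (c * k); rewrite scalerA.
by exists (c / k); rewrite scalerA divfK.
Qed.

Hypothesis cardK : #|K| = (#|F| ^ 3)%N.
Hypothesis theta_inj : injective theta.

(** The inverse of theta; the default 0 is never taken, by [psiK]. *)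
Definition psi (v : 'rV[K]_2) : 'rV[F]_6 := odflt 0 [pick u | theta u == v].

Lemma psiK v : theta (psi v) = v.
Proof.
have /codomP[u vE] : v \in codom theta.
  by apply: inj_card_onto theta_inj _ v; rewrite !card_mx cardK -expnM.
by rewrite /psi; case: pickP => [w /eqP // | /(_ u)/eqP[]]; rewrite vE.
Qed.

End Planes.

Section BruckBose.
Variables (F K : finFieldType) (iota : {rmorphism F -> K}) (tau : K).
Hypothesis cardK : #|K| = (#|F| ^ 3)%N.
Hypothesis tau_notin : forall c, tau <> iota c.

(** Composing the inverse of g with the coordinates of the standard spread
absorbs the projectivity, so that S is described like the standard spread. *)
Definition bb_coord (g : 'End('rV[F]_6)) : 'M[K]_(6, 2) :=
  map_mx iota (invmx (lin1_mx g)) *m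
  (block_mx (powers tau) 0 0 (powers tau) : 'M_(3 + 3, 1 + 1)).

Variable g : 'End('rV[F]_6).
Hypothesis g_inj : lker g = 0%VS.

Lemma lin1_unit : lin1_mx g \in unitmx.
Proof.
rewrite -row_free_unit; apply/inj_row_free => u; rewrite mul_rV_lin1 => gu0.
by apply/eqP; rewrite -memv0 -g_inj memv_ker gu0.
Qed.

Lemma mul_row_diag n (a b : 'rV[K]_n) (c : 'cV_n) :
  row_mx a b *m block_mx c 0 0 c = row_mx (a *m c) (b *m c).
Proof. by rewrite mul_row_block !mulmx0 addr0 add0r. Qed.

Lemma theta_bb_coord (a b : 'rV[F]_3) :
  theta iota (bb_coord g) (g (row_mx a b)) =
  row_mx (map_mx iota a *m powers tau) (map_mx iota b *m powers tau).
Proof.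
rewrite -[g _]mul_rV_lin1 /theta mulmxA -map_mxM mulmxK ?lin1_unit //.
rewrite (map_row_mx iota a b : map_mx iota (row_mx a b : 'rV_6) = _).
exact: (mul_row_diag (map_mx iota a) (map_mx iota b) (powers tau)).
Qed.

Lemma bb_coord_inj : injective (theta iota (bb_coord g)).
Proof.
move=> u w; have lift x : exists a b : 'rV[F]_3, x = g (row_mx a b).
  have : x \in limg g by rewrite lker0_limgf ?memvf // g_inj.
  case/memv_imgP=> y _ ->.
  exists (lsubmx (y : 'rV_(3 + 3))), (rsubmx (y : 'rV_(3 + 3))).
  by rewrite hsubmxK.
have [[a [b ->]] [c [d ->]]] := (lift u, lift w).
rewrite !theta_bb_coord => eq_cd.
have [] := @eq_row_mx _ 1 1 1 _ _ _ _ eq_cd.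
by do 2!move/(powers_inj cardK tau_notin)->.
Qed.

Lemma scale_pair (x y z : K) :
  x *: (row_mx y%:M z%:M : 'rV_2) = row_mx (y * x)%:M (z * x)%:M.
Proof. by rewrite (scale_row_mx x y%:M) !scale_scalar_mx ![x * _]mulrC. Qed.

Lemma bb_planeE alpha beta :
  (g @: bb_plane iota tau alpha beta)%VS =
  plane iota (bb_coord g) (row_mx alpha%:M beta%:M : 'rV_(1 + 1)).
Proof.
rewrite /bb_plane limg_span; apply: eq_span => u.
rewrite mem_enum inE; apply/mapP/vlineP => [[w /mapP[x _ ->] ->]|[x ux]].
  exists x; rewrite theta_bb_coord !(coordsK cardK tau_notin).
  by rewrite scale_pair.
exists (row_mx (coords iota tau (alpha * x)) (coords iota tau (beta * x))).
  by apply/mapP; exists x; rewrite ?mem_enum.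
apply: bb_coord_inj; rewrite ux theta_bb_coord !(coordsK cardK tau_notin).
by rewrite scale_pair.
Qed.

End BruckBose.

Section Infinity.
Variable K : finFieldType.

(** Splitting 3 as 2 + 1 separates the homogeneous coordinates on the line at
infinity from the one that vanishes there. *)
Lemma mem_linfty (v : 'rV[K]_(2 + 1)) : (v \in linfty K) = (rsubmx v == 0).
Proof.
apply/idP/eqP.
  case/memv_addP=> _ /vlineP[x ->] [_ /vlineP[y ->]] ->.
  by apply/rowP=> i; rewrite !mxE !ord1 /= !mulr0 addr0.
move=> v0; have -> : v = v 0 0 *: delta_mx 0 0 + v 0 1 *: delta_mx 0 1.
  apply/rowP=> -[[|[|[|//]]] lti]; rewrite !mxE /= ?mulr0 ?mulr1 ?addr0 ?add0r.
  - by congr (v 0 _); apply/val_inj.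
  - by congr (v 0 _); apply/val_inj.
  have /rowP/(_ 0) := v0; rewrite !mxE => <-.
  by congr (v 0 _); apply/val_inj.
by rewrite memv_add ?memvZ ?memv_line.
Qed.

Lemma lsubmxE (v : 'rV[K]_(2 + 1)) :
  (row_mx (v 0 0)%:M (v 0 1)%:M : 'rV_(1 + 1)) = lsubmx v.
Proof.
apply/rowP=> i; case: (@split_ordP 1 1 i) => j ->;
  by rewrite ?row_mxEl ?row_mxEr !mxE !ord1 mulr1n; congr (v 0 _); apply/val_inj.
Qed.

End Infinity.

(** * Linear algebra in dimension two *)

Section Symplectic.
Variable K : fieldType.

(** The matrix of the determinant form, used to express proportionality of two
vectors of K^2 as an equation. *)
Definition sympl : 'M[K]_2 := \matrix_(i, j) ((i < j)%N%:R - (j < i)%N%:R).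

Lemma sympl_unit : sympl \in unitmx.
Proof.
suff /mulmx1_unit[] : sympl *m - sympl = 1%:M by [].
apply/matrixP=> -[[|[|//]] ?] [[|[|//]] ?];
  by rewrite !mxE !big_ord_recl big_ord0 !mxE /=; ring.
Qed.

Lemma symplE (x y : 'cV[K]_2) :
  (x^T *m sympl *m y) 0 0 = x 0 0 * y 1 0 - x 1 0 * y 0 0.
Proof.
rewrite !mxE !big_ord_recl big_ord0 !mxE !big_ord_recl !big_ord0 !mxE /=.
have -> : lift ord0 ord0 = 1 :> 'I_2 by apply/val_inj.
by ring.
Qed.

Lemma sympl_line (v x : 'rV[K]_2) : x \in <[v]>%VS -> x *m sympl *m v^T = 0.
Proof.
case/vlineP=> k ->; apply/rowP=> i; rewrite ord1 [RHS]mxE -!scalemxAl mxE.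
by rewrite -{1}[v]trmxK symplE; ring.
Qed.

(** Both columns lie in the one-dimensional kernel of c. *)
Lemma sympl_kill (c : 'rV[K]_2) (x y : 'cV[K]_2) :
  c != 0 -> c *m x = 0 -> c *m y = 0 -> x^T *m sympl *m y = 0.
Proof.
move=> c_neq0 /rowP/(_ 0) + /rowP/(_ 0); rewrite !mxE !big_ord_recl.
rewrite !big_ord0 !addr0.
have -> : lift ord0 ord0 = 1 :> 'I_2 by apply/val_inj.
move=> cx cy; apply/rowP=> i; rewrite ord1 symplE mxE.
set e := (_ - _); move: cx cy.
set cx := (X in X = 0 -> _); set cy := (X in _ -> X = 0 -> _) => cx0 cy0.
have c0 : c 0 0 * e = 0.
  transitivity (y 1 0 * cx - x 1 0 * cy); first by rewrite /cx /cy /e; ring.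
  by rewrite cx0 cy0 !mulr0 subrr.
have c1 : c 0 1 * e = 0.
  transitivity (x 0 0 * cy - y 0 0 * cx); first by rewrite /cx /cy /e; ring.
  by rewrite cx0 cy0 !mulr0 subrr.
apply/eqP; apply: contraNT c_neq0 => det_neq0; apply/eqP/rowP.
move=> -[[|[|//]] lti]; rewrite mxE; apply: (mulIf det_neq0); rewrite mul0r.
  by rewrite -[RHS]c0; congr (c 0 _ * e); apply/val_inj.
by rewrite -[RHS]c1; congr (c 0 _ * e); apply/val_inj.
Qed.

End Symplectic.

(** The hypothesis is that one square block matrix is a left inverse of
another, and the conclusion that it is a right inverse. *)
Lemma dual_blocks (K : fieldType) m (A : 'I_3 -> 'M[K]_(m + (m + m), m))
    (V : 'I_3 -> 'M[K]_(m, m + (m + m))) :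
    (forall i j, V i *m A j = (i == j)%:R%:M) -> \sum_i A i *m V i = 1%:M.
Proof.
move=> VA; pose V' := col_mx (V 0) (col_mx (V 1) (V 2%:R)).
pose A' := row_mx (A 0) (row_mx (A 1) (A 2%:R)).
have /mulmx1C : V' *m A' = 1%:M.
  rewrite mul_col_row mul_mx_row mul_col_mx mul_col_row !VA /=.
  have -> : 0%:M = 0 :> 'M[K]_m by apply: raddf0.
  by rewrite row_mx0 col_mx0 -!scalar_mx_block.
rewrite !mul_row_col => <-; rewrite !big_ord_recl big_ord0 addr0.
by do 2!congr (_ + _); congr (A _ *m V _); apply/val_inj.
Qed.

Lemma meetsP (F : finFieldType) n (U V : {vspace 'rV[F]_n}) :
  reflect (exists2 z, z != 0 & z \in U /\ z \in V) (meets U V).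
Proof.
apply: (iffP idP) => [UV0 | [z z_neq0 zUV]].
  by exists (vpick (U :&: V)); rewrite ?vpick0 //; apply/memv_capP/memv_pick.
by apply: contra z_neq0 => /eqP UV0; rewrite -memv0 -UV0; apply/memv_capP.
Qed.

Lemma vspace_basis_mx (K : fieldType) n d (l : {vspace 'rV[K]_n}) : \dim l = d ->
  exists L : 'M[K]_(d, n), row_free L /\ forall z, (z \in l) = (z <= L)%MS.
Proof.
move=> <-; exists (\matrix_(r < \dim l) (vbasis l)`_r).
have mulL (c : 'rV_(\dim l)) :
    c *m (\matrix_(r < \dim l) (vbasis l)`_r) = \sum_r c 0 r *: (vbasis l)`_r.
  by rewrite mulmx_sum_row; apply: eq_bigr => r _; rewrite rowK.
split.
  apply: inj_row_free => c; rewrite mulL => cL0; apply/rowP=> r; rewrite mxE.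
  by have /freeP/(_ (fun r => c 0 r) cL0) := basis_free (vbasisP l).
move=> z; apply/idP/submxP => [zl|[c ->]].
  exists (\row_r coord (vbasis l) r z); rewrite mulL {1}(coord_vbasis zl).
  by apply: eq_bigr => r _; rewrite mxE.
rewrite mulL rpred_sum // => r _; rewrite memvZ // vbasis_mem //.
by rewrite mem_nth ?size_tuple.
Qed.

(** * The three conjugate transversals of the spread *)

Section Transversals.
Variables (F K : finFieldType) (iota : {rmorphism F -> K}) (tau : K).
Hypothesis cardK : #|K| = (#|F| ^ 3)%N.
Hypothesis tau_notin : forall c, tau <> iota c.
Variable E : 'M[K]_(6, 2).
Hypothesis theta_inj : injective (theta iota E).

Local Notation plane := (plane iota E).

Definition frobmx m n (i : 'I_3) (A : 'M[K]_(m, n)) : 'M_(m, n) :=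
  map_mx (frob iota i) A.

Lemma frobmx_iota m n i (A : 'M[F]_(m, n)) :
  frobmx i (map_mx iota A) = map_mx iota A.
Proof. by apply/matrixP=> k l; rewrite !mxE /= frob_iota. Qed.

Lemma frobmxM m n p i (A : 'M[K]_(m, n)) (B : 'M_(n, p)) :
  frobmx i (A *m B) = frobmx i A *m frobmx i B.
Proof. exact: map_mxM. Qed.

Lemma frobmx_theta i u : map_mx iota u *m frobmx i E = frobmx i (theta iota E u).
Proof. by rewrite frobmxM frobmx_iota. Qed.

(** This turns the fact that a line meets an extended plane into equations on
the components of one of its points. *)
Lemma mem_extend_frobmx i v z :
  z \in extend iota (plane v) -> z *m frobmx i E \in <[frobmx i v]>%VS.
Proof.
suff: (extend iota (plane v) <=
         linfun (mulmxr (frobmx i E)) @^-1: <[frobmx i v]>)%VS.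
  by move=> /subvP sub /sub; rewrite -memv_preim lfunE.
apply/span_subvP => _ /imageP[u uv ->]; rewrite -memv_preim lfunE /= frobmx_theta.
move: uv; rewrite mem_plane => /vlineP[k ->].
by rewrite /frobmx map_mxZ memvZ ?memv_line.
Qed.

(** The point of the i-th transversal in the extension of the plane of s: the
coefficients invert the Moore matrix, which cancels all the components of the
point but the i-th. *)
Definition conj_point (i : 'I_3) (s : 'rV[K]_2) : 'rV[K]_6 :=
  \sum_k invmx (moore iota tau) i k *: map_mx iota (psi iota E (tau ^+ k *: s)).

Lemma conj_point_extend i s : conj_point i s \in extend iota (plane s).
Proof.
apply: rpred_sum => k _; apply/memvZ/memv_span/image_f.
by rewrite mem_plane psiK // memvZ ?memv_line.
Qed.

Lemma conj_pointE i j s :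
  conj_point i s *m frobmx j E = (i == j)%:R *: frobmx j s.
Proof.
have /matrixP/(_ i j) := mulVmx (moore_unit cardK tau_notin).
rewrite !mxE => <-; rewrite mulmx_suml scaler_suml; apply: eq_bigr => k _.
by rewrite -scalemxAl frobmx_theta psiK // /frobmx map_mxZ scalerA !mxE rmorphXn.
Qed.

(** Two rows that span the i-th transversal. *)
Definition conj_basis (i : 'I_3) : 'M[K]_(2, 6) :=
  \matrix_r conj_point i (delta_mx 0 r).

Lemma conj_basisE i j : conj_basis i *m frobmx j E = (i == j)%:R%:M.
Proof.
apply/row_matrixP => r; rewrite row_mul rowK conj_pointE /frobmx map_delta_mx.
by rewrite -[_%:M]scalemx1 linearZ /= row1.
Qed.

Lemma conj_basis_sum : \sum_i frobmx i E *m conj_basis i = 1%:M.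
Proof. exact: (@dual_blocks K 2 (fun i => frobmx i E) conj_basis conj_basisE). Qed.

Definition conj_line i : {vspace 'rV[K]_6} :=
  limg (linfun (mulmxr (conj_basis i) : 'rV_2 -> 'rV_6)).

Lemma mem_conj_line i z :
  (forall j, j != i -> z *m frobmx j E = 0) -> z \in conj_line i.
Proof.
move=> z0; suff -> : z = linfun (mulmxr (conj_basis i)) (z *m frobmx i E).
  exact/memv_img/memvf.
rewrite lfunE /= -{1}[z]mulmx1 -conj_basis_sum mulmx_sumr (bigD1 i) //=.
by rewrite big1 ?addr0 ?mulmxA // => j ji; rewrite mulmxA z0 // mul0mx.
Qed.

Lemma dim_conj_line i : \dim (conj_line i) = 2%N.
Proof.
rewrite limg_dim_eq ?dimvf //; apply/eqP; rewrite -subv0; apply/subvP=> s.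
rewrite memv_cap memv_ker lfunE memv0 /= => /andP[_ /eqP].
move/(congr1 (mulmxr (frobmx i E))).
by rewrite /= -mulmxA conj_basisE eqxx mulmx1 mul0mx => ->.
Qed.

Lemma frobmx_eq0 m n i (A : 'M[K]_(m, n)) : (frobmx i A == 0) = (A == 0).
Proof. exact: map_mx_eq0. Qed.

Lemma conj_line_meets i v : v != 0 -> meets (conj_line i) (extend iota (plane v)).
Proof.
move=> v_neq0; apply/meetsP; exists (conj_point i v); last first.
  split; last exact: conj_point_extend.
  apply: mem_conj_line => j /negPf ji.
  by rewrite conj_pointE eq_sym ji scale0r.
rewrite -(frobmx_eq0 i) in v_neq0; apply: contraNneq v_neq0 => z0.
by have := conj_pointE i i v; rewrite z0 mul0mx eqxx scale1r => <-.
Qed.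

Lemma conj_line_inj : injective conj_line.
Proof.
move=> i j eq_ij; apply/eqP; apply: contraT => neq_ij.
have : conj_point i (delta_mx 0 0) \in conj_line j.
  rewrite -eq_ij; apply: mem_conj_line => k /negPf ki.
  by rewrite conj_pointE eq_sym ki scale0r.
case/memv_imgP=> s _; rewrite lfunE /= => /(congr1 (mulmxr (frobmx i E))).
rewrite /= conj_pointE -mulmxA conj_basisE eqxx scale1r eq_sym (negPf neq_ij).
rewrite [X in _ *m X](_ : _ = 0); last exact: raddf0.
rewrite mulmx0 => /eqP; rewrite frobmx_eq0 => /eqP/rowP/(_ 0).
by rewrite !mxE => /eqP; rewrite oner_eq0.
Qed.

End Transversals.

(** * Transversals of a linear set of rank three *)

(** The splash enters here only through a and U: it contains the planes of the
vectors f U with f rational. *)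
Section SplashTransversals.
Variables (F K : finFieldType) (iota : {rmorphism F -> K}) (tau : K).
Hypothesis cardK : #|K| = (#|F| ^ 3)%N.
Hypothesis tau_notin : forall c, tau <> iota c.

Variables (a : 'rV[K]_3) (U : 'M[K]_(3, 2)).
Hypothesis a_free : forall f : 'rV[F]_3, map_mx iota f *m a^T = 0 -> f = 0.
Hypothesis kerU : forall r : 'rV[K]_3, r *m U = 0 <-> (r <= a)%MS.

Definition splash_vec (f : 'rV[F]_3) : 'rV[K]_2 := map_mx iota f *m U.

Local Notation frobmx := (frobmx iota).

Lemma mulmx_delta n (M : 'M[K]_n) k l :
  delta_mx 0 k *m M *m (delta_mx 0 l)^T = (M k l)%:M :> 'M_1.
Proof.
by rewrite -rowE trmx_delta -colE [LHS]mx11_scalar !mxE.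
Qed.

(** A quadratic form over K that vanishes at the rational vectors e_k and
e_k + e_l is zero, whatever the characteristic. *)
Lemma rational_alternating (M : 'M[K]_3) :
    (forall f : 'rV[F]_3, map_mx iota f *m M *m (map_mx iota f)^T = 0) ->
  (forall k, M k k = 0) /\ (forall k l, M k l + M l k = 0).
Proof.
move=> M0; have M_diag k : M k k = 0.
  have := M0 (delta_mx 0 k); rewrite map_delta_mx mulmx_delta.
  by move/rowP/(_ 0); rewrite !mxE.
split=> // k l; have /rowP/(_ 0) := M0 (delta_mx 0 k + delta_mx 0 l).
rewrite map_mxD !map_delta_mx linearD /= !mulmxDl !mulmxDr !mulmx_delta !mxE.
by rewrite !M_diag !mulr1n add0r addr0 addrC.
Qed.

Lemma a_ratio k m c : k != m -> a 0 k <> iota c * a 0 m.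
Proof.
move=> neq_km akE.
have /rowP/(_ k) : delta_mx 0 k - c *: delta_mx 0 m = 0 :> 'rV[F]_3.
  apply: a_free; rewrite map_mxB map_mxZ !map_delta_mx mulmxBl -scalemxAl -!rowE.
  by apply/rowP=> i; rewrite ord1 !mxE akE subrr.
by rewrite !mxE !eqxx (negPf neq_km) mulr0 subr0 => /eqP; rewrite oner_eq0.
Qed.

(** If two conjugates of a had proportional coordinates k and m, then the
ratio of these coordinates of a would be in F. *)
Lemma a_conj_indep (i j : 'I_3) k m : i != j -> k != m ->
  frobmx i a 0 k * frobmx j a 0 m - frobmx i a 0 m * frobmx j a 0 k != 0.
Proof.
move=> neq_ij neq_km; rewrite subr_eq0; apply/eqP; rewrite !mxE /=.
have am_neq0 : a 0 m != 0.
  apply/eqP=> am0; have := @a_ratio m k 0; rewrite rmorph0 mul0r am0 eq_sym.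
  by move/(_ neq_km).
move=> eq_a; have : frob iota i (a 0 k / a 0 m) = frob iota j (a 0 k / a 0 m).
  rewrite !fmorph_div /=; apply/eqP; rewrite eqr_div ?fmorph_eq0 //.
  by rewrite eq_a mulrC.
case/(frob_eq cardK neq_ij) => c akE; apply: (@a_ratio k m c neq_km).
by rewrite -akE divfK.
Qed.

(** A nonzero alternating matrix of size 3 has a one-dimensional kernel.  With
m the third index, column l of the two kernel equations is a linear system in
M k l and M m l, whose determinant is a 2 x 2 minor of the conjugates of a. *)
Lemma alternating_ker (M : 'M[K]_3) i j : i != j ->
  (forall k, M k k = 0) -> (forall k l, M k l + M l k = 0) ->
  frobmx i a *m M = 0 -> frobmx j a *m M = 0 -> M = 0.
Proof.
move=> neq_ij M_diag M_alt aiM ajM; apply/matrixP=> k l; rewrite mxE.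
have [<- | neq_kl] := eqVneq k l; first exact: M_diag.
have /cards1P[m mE] : #|~: [set k; l]| == 1%N.
  by rewrite cardsCs setCK card_ord cards2 neq_kl.
have in_m x : (x != k) && (x != l) = (x == m).
  by rewrite -[RHS]in_set1 -mE !inE negb_or.
have /andP[neq_mk neq_ml] : (m != k) && (m != l) by rewrite in_m.
have sum_a (r : 'rV_3) : r *m M = 0 -> r 0 k * M k l + r 0 m * M m l = 0.
  move/rowP/(_ l); rewrite !mxE (bigD1 k) //= (bigD1 l) 1?eq_sym //=.
  by rewrite M_diag mulr0 add0r (big_pred1 m).
apply: (mulfI (a_conj_indep neq_ij neq_mk)); rewrite mulr0.
have := sum_a _ aiM; have := sum_a _ ajM.
set x := M k l; set y := M m l; set c := frobmx i a 0 m; set d := frobmx j a 0 m.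
set e := frobmx i a 0 k; set f := frobmx j a 0 k => eq1 eq2.
transitivity (c * (f * x + d * y) - d * (e * x + c * y)); first by ring.
by rewrite eq1 eq2 !mulr0 subrr.
Qed.

Lemma U_left_inv : exists P, P *m U = 1%:M.
Proof.
exists (pinvmx U); apply: mulVpmx; rewrite -col_leq_rank.
have : (\rank (kermx U) <= 1)%N.
  apply: leq_trans (rank_leq_row a); apply/mxrankS/row_subP => r.
  by apply/kerU; rewrite -row_mul mulmx_ker row0.
by rewrite mxrank_ker; case: (\rank U) => [|[]].
Qed.

(** With M the pullback of B by the conjugates of U, the form f M f^T is zero
on rational vectors, so M is alternating.  The conjugates of a kill the
corresponding conjugates of U, which puts one of them in the left kernel of M
and another one in its right kernel, and these kernels coincide. *)
Lemma splash_no_sesqui i j (B : 'M[K]_2) : i != j ->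
    (forall f, frobmx i (splash_vec f) *m B *m (frobmx j (splash_vec f))^T = 0) ->
  B = 0.
Proof.
move=> neq_ij B0; pose M := frobmx i U *m B *m (frobmx j U)^T.
have M0 (f : 'rV[F]_3) : map_mx iota f *m M *m (map_mx iota f)^T = 0.
  by rewrite -(B0 f) /splash_vec !frobmxM !frobmx_iota trmx_mul !mulmxA.
have [M_diag M_alt] := rational_alternating M0.
have MT : M^T = - M.
  by apply/matrixP=> k l; rewrite mxE [RHS]mxE; apply/eqP; rewrite -addr_eq0 M_alt.
have aU : a *m U = 0 by apply/kerU.
have frobmx_aU h : frobmx h a *m frobmx h U = 0.
  by rewrite -frobmxM aU /frobmx map_mx0.
have : M = 0.
  apply: (alternating_ker neq_ij) => //; first by rewrite !mulmxA frobmx_aU !mul0mx.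
  apply: oppr_inj; rewrite oppr0 -mulmxN -MT !trmx_mul trmxK !mulmxA frobmx_aU.
  by rewrite !mul0mx.
have [P PU] := U_left_inv.
have frobmx_PU h : frobmx h P *m frobmx h U = 1%:M.
  by rewrite -frobmxM PU /frobmx map_mx1.
move/(congr1 (fun X => frobmx i P *m X *m (frobmx j P)^T)).
rewrite mulmx0 mul0mx => <-; rewrite /M !mulmxA frobmx_PU mul1mx.
by rewrite -mulmxA -trmx_mul frobmx_PU trmx1 mulmx1.
Qed.

Variable E : 'M[K]_(6, 2).
Hypothesis theta_inj : injective (theta iota E).

(** The matrix A i below represents the i-th component of the points of l,
followed by the determinant form.  [splash_no_sesqui] makes every column of A i
proportional to every column of A j, for i != j.  If A i and A j were both
nonzero, then all the columns of the three matrices would be multiples of a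
single one, and a nonzero row killing it would give a point of l with three
zero components. *)
Lemma splash_transversal (l : {vspace 'rV[K]_6}) : \dim l = 2%N ->
  (forall f, f != 0 -> meets l (extend iota (plane iota E (splash_vec f)))) ->
  exists i, l = conj_line iota tau E i.
Proof.
move=> dim_l l_meets; have [L [L_free mem_l]] := vspace_basis_mx dim_l.
pose A i := L *m frobmx i E *m sympl K.
have AA i j : i != j -> (A i)^T *m sympl K *m A j = 0.
  move=> neq_ij; apply: (splash_no_sesqui neq_ij) => f.
  have [->|f_neq0] := eqVneq f 0.
    by rewrite /splash_vec map_mx0 mul0mx /frobmx !map_mx0 !mul0mx.
  have /meetsP[z z_neq0 [zl zf]] := l_meets f f_neq0.
  move: zl; rewrite mem_l => /submxP[c zE].
  have c_neq0 : c != 0 by apply: contraNneq z_neq0 => c0; rewrite zE c0 mul0mx.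
  have cA h : c *m (A h *m (frobmx h (splash_vec f))^T) = 0.
    by rewrite !mulmxA -zE sympl_line ?mem_extend_frobmx.
  have := sympl_kill c_neq0 (cA i) (cA j).
  by rewrite trmx_mul trmxK !mulmxA.
suff [i Ai] : exists i, forall j, j != i -> A j = 0.
  exists i; apply/eqP; rewrite eqEdim dim_conj_line // dim_l leqnn andbT.
  apply/subvP=> z; rewrite mem_l => /submxP[c ->]; apply: mem_conj_line => // j ji.
  have := Ai j ji; move/(congr1 (mulmxr (invmx (sympl K)))).
  by rewrite /= mulmxK ?sympl_unit // mul0mx -mulmxA => ->; rewrite mulmx0.
case: (pickP (fun i => A i != 0)) => [i Ai_neq0 | A0]; last first.
  by exists 0 => j _; have /negbFE/eqP := A0 j.
exists i => j neq_ji; apply/eqP; apply: contraT => Aj_neq0.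
have neq_ij : i != j by rewrite eq_sym.
have col_neq0 h : A h != 0 -> exists x, col x (A h) != 0.
  move=> Ah; apply/existsP; apply: contraR Ah => /existsPn Ah0.
  by apply/eqP/matrixP=> p x; have /negbNE/eqP/colP/(_ p) := Ah0 x; rewrite !mxE.
have row_neq0 (x : 'cV_2) : x != 0 -> x^T *m sympl K != 0.
  apply: contra_neq => /(congr1 (mulmxr (invmx (sympl K)))).
  by rewrite /= mulmxK ?sympl_unit // mul0mx => /(congr1 trmx); rewrite trmxK trmx0.
have [[x xi] [y yj]] := (col_neq0 _ Ai_neq0, col_neq0 _ Aj_neq0).
have killed k h z w : k != h -> (col z (A k))^T *m sympl K *m col w (A h) = 0.
  move=> /AA AA0.
  transitivity (delta_mx (0 : 'I_1) z *m ((A k)^T *m sympl K *m A h)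
                *m delta_mx w (0 : 'I_1)).
    by rewrite tr_col rowE colE !mulmxA.
  by rewrite AA0 mulmx0 mul0mx.
pose r := (col x (A i))^T *m sympl K.
have rA k : r *m A k = 0.
  apply/rowP=> w; suff /colP/(_ 0) : r *m col w (A k) = 0.
    by rewrite colE mulmxA -colE !mxE.
  (* The columns of A i are compared with each other through column y of A j. *)
  have [->|neq_ki] := eqVneq k i; last by apply: killed; rewrite eq_sym.
  apply: sympl_kill (row_neq0 _ yj) _ _; exact: killed.
have rL : r *m L = 0.
  rewrite -[r *m L]mulmx1 -(conj_basis_sum cardK tau_notin theta_inj) mulmx_sumr.
  apply: big1 => k _; rewrite mulmxA.
  have /(congr1 (mulmxr (invmx (sympl K)))) := rA k.
  by rewrite /A /= !mulmxA mulmxK ?sympl_unit // mul0mx => ->; rewrite mul0mx.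
have := row_neq0 _ xi; rewrite -/r => /eqP[].
by apply: (row_free_inj L_free); rewrite rL mul0mx.
Qed.

End SplashTransversals.

(** * The cross product *)

Section CrossProduct.
Variable K : fieldType.

(** Indices are taken modulo 3, so that k, k + 1 and k + 2 enumerate them from
any starting point. *)
Lemma ord3_cycle (k : 'I_3) :
  [/\ k + 1 + 1 = k + 2%:R, k + 1 + 2%:R = k,
      k + 2%:R + 1 = k & k + 2%:R + 2%:R = k + 1].
Proof. by case: k => [[|[|[|//]]] ?]; split; apply/val_inj. Qed.

Lemma ord3_neq (k : 'I_3) :
  ((k == k + 1) = false) * ((k == k + 2%:R) = false) *
  ((k + 1 == k) = false) * ((k + 1 == k + 2%:R) = false) *
  ((k + 2%:R == k) = false) * ((k + 2%:R == k + 1) = false).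
Proof. by case: k => [[|[|[|//]]] ?]. Qed.

Lemma ord3P (k j : 'I_3) : [\/ j = k, j = k + 1 | j = k + 2%:R].
Proof.
by case: k j => [[|[|[|//]]] ?] [[|[|[|//]]] ?];
  try (by constructor 1; apply/val_inj); try (by constructor 2; apply/val_inj);
  constructor 3; apply/val_inj.
Qed.

Lemma sum_ord3 (k : 'I_3) (G : 'I_3 -> K) :
  \sum_i G i = G k + G (k + 1) + G (k + 2%:R).
Proof.
rewrite (bigD1 k) //= (bigD1 (k + 1)) /= ?ord3_neq //.
rewrite (big_pred1 (k + 2%:R)) ?addrA // => j.
by case: k j => [[|[|[|//]]] ?] [[|[|[|//]]] ?].
Qed.

(** The matrix of right multiplication by a in the cross product. *)
Definition cross (a : 'rV[K]_3) : 'M[K]_3 :=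
  \matrix_(i, j) ((i == j + 1)%:R * a 0 (j + 2%:R)
                  - (i == j + 2%:R)%:R * a 0 (j + 1)).

Lemma crossE (r a : 'rV[K]_3) j :
  (r *m cross a) 0 j = r 0 (j + 1) * a 0 (j + 2%:R) - r 0 (j + 2%:R) * a 0 (j + 1).
Proof.
by rewrite mxE (sum_ord3 j) !mxE !eqxx !(ord3_neq j) /=; ring.
Qed.

Lemma cross_orthol (r a : 'rV[K]_3) : r *m cross a *m r^T = 0.
Proof.
apply/rowP=> i; have [e11 e12 e21 e22] := ord3_cycle 0.
rewrite ord1 mxE (sum_ord3 0) !crossE e11 e12 e21 e22 /trmx !mxE; ring.
Qed.

Lemma cross_orthor (r a : 'rV[K]_3) : r *m cross a *m a^T = 0.
Proof.
apply/rowP=> i; have [e11 e12 e21 e22] := ord3_cycle 0.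
rewrite ord1 mxE (sum_ord3 0) !crossE e11 e12 e21 e22 /trmx !mxE; ring.
Qed.

Lemma cross_eq0 (r a : 'rV[K]_3) :
  r *m cross a = 0 -> forall i j, r 0 i * a 0 j = r 0 j * a 0 i.
Proof.
move=> ra0 i j; have [e11 e12 e21 e22] := ord3_cycle i.
have ra k : r 0 (k + 1) * a 0 (k + 2%:R) = r 0 (k + 2%:R) * a 0 (k + 1).
  by apply/eqP; rewrite -subr_eq0 -crossE ra0 mxE.
case: (ord3P i j) => -> //.
  by have := ra (i + 2%:R); rewrite e21 e22.
by have := ra (i + 1); rewrite e11 e12 => ->.
Qed.

Lemma proportional_of_cross (r a : 'rV[K]_3) :
  a != 0 -> r *m cross a = 0 -> exists c, r = c *: a.
Proof.
case/rV0Pn=> i ai /cross_eq0 ra; exists (r 0 i / a 0 i).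
by apply/rowP=> j; rewrite [RHS]mxE mulrAC ra mulfK.
Qed.

(** The vectors edge (k + 1) and edge (k + 2) are rational when f is: they are
two points that span the line with equation f. *)
Lemma orthogonal_span (f y : 'rV[K]_3) k : f 0 k != 0 -> y *m f^T = 0 ->
  let edge m := f 0 m *: delta_mx 0 k - f 0 k *: delta_mx 0 m in
  exists c d, y = c *: edge (k + 1) + d *: edge (k + 2%:R).
Proof.
move=> fk yf edge.
exists (- y 0 (k + 1) / f 0 k), (- y 0 (k + 2%:R) / f 0 k).
have /rowP/(_ 0) := yf; rewrite mxE (sum_ord3 k) !mxE => yf0.
have yk : y 0 k =
    - (y 0 (k + 1) * f 0 (k + 1) + y 0 (k + 2%:R) * f 0 (k + 2%:R)) / f 0 k.
  by apply: canRL (mulfK fk) _; apply/eqP; rewrite -addr_eq0 addrA yf0.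
apply/rowP=> j; case: (ord3P k j) => ->;
  rewrite !mxE !eqxx !(ord3_neq k) ?yk /=; field.
all: exact: fk.
Qed.

End CrossProduct.

(** * The splash as a linear set *)

(** If f were proportional to a, the rational vectors f_i e_j - f_j e_i would be
orthogonal to a. *)
Lemma free_rational_sub (F K : finFieldType) (iota : {rmorphism F -> K})
    (a : 'rV[K]_3) :
    (forall f : 'rV[F]_3, map_mx iota f *m a^T = 0 -> f = 0) ->
  forall f : 'rV[F]_3, (map_mx iota f <= a)%MS -> f = 0.
Proof.
move=> a_free f /sub_rVP[k fE].
have fka i j : iota (f 0 i) * a 0 j = iota (f 0 j) * a 0 i.
  have /rowP fE' := fE.
  by have := fE' i; have := fE' j; rewrite !mxE => -> ->; ring.
apply/rowP=> i; rewrite mxE.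
have /rowP/(_ (i + 1)) :
    f 0 i *: delta_mx 0 (i + 1) - f 0 (i + 1) *: delta_mx 0 i = 0 :> 'rV[F]_3.
  apply: a_free.
  rewrite map_mxB !map_mxZ !map_delta_mx mulmxBl -!scalemxAl -!rowE.
  by apply/rowP=> x; rewrite ord1 !mxE fka subrr.
by rewrite !mxE !eqxx !(ord3_neq i) /= mulr1 mulr0 subr0.
Qed.


Section Splash.
Variables (F K : finFieldType) (iota : {rmorphism F -> K}).
Variable g : 'End('rV[K]_3).
Hypothesis g_inj : lker g = 0%VS.

Definition subplane_of (h : 'End('rV[K]_3)) : {set {vspace 'rV[K]_3}} :=
  [set (h @: extend iota P)%VS | P : {vspace 'rV[F]_3} & \dim P == 1%N].

Hypothesis g_ext : exterior (subplane_of g).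

Lemma extend_line n (f : 'rV[F]_n) : extend iota <[f]> = <[map_mx iota f]>%VS.
Proof.
apply/eqP; rewrite eqEsubv; apply/andP; split.
  apply/span_subvP => _ /imageP[u /vlineP[c ->] ->].
  by rewrite map_mxZ memvZ ?memv_line.
by rewrite -memvE; apply/memv_span/image_f/memv_line.
Qed.

(** The equation of the line at infinity, in the coordinates of the subplane. *)
Definition infty_form : 'rV[K]_3 := (rsubmx (lin1_mx g : 'M_(3, 2 + 1)))^T.

(** Sends the line f of the subplane to its point at infinity: in the
coordinates of the subplane this point is orthogonal to both f and the form at
infinity, so it is their cross product. *)
Definition splash_mx : 'M[K]_(3, 2) :=
  cross infty_form *m lsubmx (lin1_mx g : 'M_(3, 2 + 1)).

Lemma mem_subplane (f : 'rV[F]_3) : f != 0 ->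
  <[map_mx iota f *m lin1_mx g]>%VS \in subplane_of g.
Proof.
move=> f_neq0; apply/imsetP; exists <[f]>%VS; first by rewrite inE dim_vline f_neq0.
by rewrite extend_line limg_line mul_rV_lin1.
Qed.

(** The points of the subplane are rational vectors, and none is at infinity. *)
Lemma infty_form_free (f : 'rV[F]_3) : map_mx iota f *m infty_form^T = 0 -> f = 0.
Proof.
move=> fa; apply/eqP; apply: contraT => f_neq0.
have := g_ext (mem_subplane f_neq0); rewrite -memvE.
rewrite (mem_linfty (_ : 'rV_(2 + 1))).
move: fa; rewrite /infty_form trmxK -mulmx_rsub => ->.
by rewrite eqxx.
Qed.

Lemma ker_splash_mx (r : 'rV[K]_3) : r *m splash_mx = 0 <-> (r <= infty_form)%MS.
Proof.
rewrite mulmxA mulmx_lsub; set N : 'M_(3, 2 + 1) := lin1_mx g; set a := infty_form.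
have := cross_orthor r a; rewrite {2}/a /infty_form trmxK mulmx_rsub -/N => rsub0.
split=> [lsub0|/sub_rVP[k ->]]; last first.
  suff -> : k *: a *m cross a = 0 by rewrite mul0mx; apply/rowP=> i; rewrite !mxE.
  by apply/rowP=> j; rewrite crossE !mxE; ring.
have : r *m cross a = 0.
  apply/eqP; rewrite -memv0 -g_inj memv_ker -mul_rV_lin1 -/N -[_ *m N]hsubmxK.
  by rewrite rsub0 lsub0 row_mx0.
move=> ra0; apply/sub_rVP/proportional_of_cross => //.
apply: contraT => /negbNE/eqP a0.
have : delta_mx 0 0 = 0 :> 'rV[F]_3.
  by apply: infty_form_free; rewrite -/a a0 trmx0 mulmx0.
by move/rowP/(_ 0); rewrite !mxE => /eqP; rewrite oner_eq0.
Qed.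

Lemma mem_splash (f : 'rV[F]_3) : f != 0 ->
  exists v : 'rV[K]_(2 + 1),
    <[v]>%VS \in splash (subplane_of g) /\ lsubmx v = map_mx iota f *m splash_mx.
Proof.
move=> f_neq0; set a := infty_form; set N : 'M_(3, 2 + 1) := lin1_mx g.
pose y := map_mx iota f *m cross a.
have v_infty : rsubmx (y *m N) = 0.
  by rewrite -mulmx_rsub -[rsubmx N]trmxK; apply: cross_orthor.
have lsub_v : lsubmx (y *m N) = map_mx iota f *m splash_mx.
  by rewrite -mulmx_lsub -mulmxA.
exists (y *m N); split=> //.
have v_neq0 : y *m N != 0.
  apply: contra_neq f_neq0 => v0.
  apply/(free_rational_sub infty_form_free)/ker_splash_mx.
  by rewrite -lsub_v v0; apply/rowP=> i; rewrite !mxE.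
rewrite 2!inE dim_vline v_neq0 eqxx -memvE (mem_linfty (y *m N)) v_infty eqxx /=.
have /rV0Pn[k fk] := f_neq0.
pose edge m : 'rV[F]_3 := f 0 m *: delta_mx 0 k - f 0 k *: delta_mx 0 m.
have edge_m m : m != k -> edge m 0 m = - f 0 k.
  by move=> /negPf mk; rewrite !mxE !eqxx mk mulr0 mulr1 sub0r.
have edge_neq0 m : m != k -> edge m != 0.
  by move=> mk; apply: contraNneq fk => em; rewrite -oppr_eq0 -(edge_m m mk) em mxE.
pose p1 := edge (k + 1); pose p2 := edge (k + 2%:R).
have k1 : k + 1 != k by rewrite ord3_neq.
have k2 : k + 2%:R != k by rewrite ord3_neq.
have p2_k1 : p2 0 (k + 1) = 0 by rewrite !mxE !(ord3_neq k) /= !mulr0 subrr.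
apply/exists_inP; exists <[map_mx iota p1 *m N]>%VS.
  exact/mem_subplane/edge_neq0.
apply/exists_inP; exists <[map_mx iota p2 *m N]>%VS.
  exact/mem_subplane/edge_neq0.
apply/andP; split.
  apply: contraNneq fk => eq_line.
  have : map_mx iota p1 *m N \in <[map_mx iota p2 *m N]>%VS.
    by rewrite -eq_line memv_line.
  case/vlineP=> c; rewrite scalemxAl => /eqP.
  rewrite -subr_eq0 -mulmxBl mul_rV_lin1 -memv_ker g_inj memv0 subr_eq0.
  move/eqP/rowP/(_ (k + 1)); rewrite [LHS]mxE [RHS]mxE [X in _ = _ * X]mxE.
  rewrite edge_m // p2_k1 rmorph0 mulr0 rmorphN => /eqP.
  by rewrite oppr_eq0 fmorph_eq0.
have fk' : map_mx iota f 0 k != 0 by rewrite mxE fmorph_eq0.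
have [c [d yE]] := orthogonal_span fk' (cross_orthol (map_mx iota f) a).
rewrite -memvE -/y in yE *; rewrite {}yE mulmxDl -!scalemxAl.
have edgeE m : map_mx iota f 0 m *: delta_mx 0 k - map_mx iota f 0 k *: delta_mx 0 m
    = map_mx iota (edge m).
  by rewrite map_mxB !map_mxZ !map_delta_mx !mxE.
by rewrite !edgeE memv_add // memvZ ?memv_line.
Qed.

End Splash.

Section Structure.
Variables (F K : finFieldType) (iota : {rmorphism F -> K}) (tau : K).
Hypothesis cardK : #|K| = (#|F| ^ 3)%N.
Hypothesis tau_notin : forall c, tau <> iota c.

(** For X the whole line at infinity this describes S, for X a splash the set
of its planes. *)
Lemma linfty_bruck_bose (g : 'End('rV[F]_6)) (X : {set {vspace 'rV[K]_3}}) W :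
    lker g = 0%VS ->
  reflect (exists2 v : 'rV[K]_(2 + 1), <[v]>%VS \in X &
             W = plane iota (bb_coord iota tau g) (lsubmx v))
          (W \in [set (g @: U)%VS | U in bruck_bose iota tau X]).
Proof.
move=> g_inj; apply: (iffP imsetP) => [[U /imsetP[v] + ->] -> | [v vX ->]].
  rewrite inE => vX; exists v => //; rewrite bb_planeE //; congr plane.
  exact: lsubmxE.
exists (bb_plane iota tau (v 0 0) (v 0 1)).
  by apply/imsetP; exists v; rewrite ?inE.
by rewrite bb_planeE //; congr plane; rewrite lsubmxE.
Qed.

(** What the rest of the proof uses of the spread and of the splash. *)
Lemma exterior_splashP S SS : exterior_splash iota tau S SS ->
  exists (E : 'M[K]_(6, 2)) (a : 'rV[K]_3) (U : 'M[K]_(3, 2)),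
  [/\ injective (theta iota E),
      forall W, W \in S <-> exists2 v, v != 0 & W = plane iota E v,
      forall f : 'rV[F]_3, map_mx iota f *m a^T = 0 -> f = 0,
      forall r : 'rV[K]_3, r *m U = 0 <-> (r <= a)%MS &
      SS \subset S /\
      forall f, f != 0 -> plane iota E (splash_vec iota U f) \in SS].
Proof.
case=> g [g_inj SE [pi [[h h_inj piE] pi_ext SSE]]]; subst pi.
exists (bb_coord iota tau g), (infty_form h), (splash_mx h).
split.
- exact: bb_coord_inj.
- move=> W; rewrite SE; split.
    case/(linfty_bruck_bose _ _ g_inj)=> v.
    rewrite !inE dim_vline -memvE mem_linfty.
    case: (v =P 0) => //= v_neq0 vinf -> ; exists (lsubmx v) => //.
    apply: contra_notN v_neq0 => /eqP v0.
    by rewrite -[v]hsubmxK v0 (eqP vinf) row_mx0.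
  case=> v v_neq0 ->; apply/linfty_bruck_bose => //; exists (row_mx v 0).
    rewrite !inE dim_vline -memvE mem_linfty row_mxKr eqxx andbT.
    rewrite (_ : _ != 0) //; apply: contraNneq v_neq0 => w0.
    by rewrite -(row_mxKl v (0 : 'rV_1)) w0; apply/eqP/rowP=> x; rewrite !mxE.
  by rewrite row_mxKl.
- exact: (infty_form_free pi_ext).
- exact: (ker_splash_mx h_inj pi_ext).
split.
  rewrite SSE SE; apply/subsetP=> W /(linfty_bruck_bose _ _ g_inj)[v vX ->].
  apply/linfty_bruck_bose => //; exists v => //.
  by move: vX; rewrite !inE => /andP[-> /andP[->]].
move=> f /(mem_splash h_inj pi_ext)[v [vS vE]].
by rewrite SSE; apply/linfty_bruck_bose => //; exists v; rewrite ?vE.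
Qed.

End Structure.

(** * Spreads that contain a splash *)

Section Uniqueness.
Variables (F K : finFieldType) (iota : {rmorphism F -> K}).
Hypothesis cardK : #|K| = (#|F| ^ 3)%N.

Lemma spread_cover (S : {set {vspace 'rV[F]_6}}) u : spread S -> u != 0 ->
  exists2 W, W \in S & u \in W.
Proof.
case=> _ _ cover u_neq0; have [|W [[WS uW] _]] := cover <[u]>%VS.
  by rewrite dim_vline u_neq0.
by exists W; rewrite // memvE.
Qed.

Lemma spread_disjoint (S : {set {vspace 'rV[F]_6}}) u V W : spread S -> u != 0 ->
  V \in S -> W \in S -> u \in V -> u \in W -> V = W.
Proof.
case=> _ _ cover u_neq0 VS WS uV uW; have [|X [_ X_uniq]] := cover <[u]>%VS.
  by rewrite dim_vline u_neq0.
have XE Y : Y \in S -> u \in Y -> X = Y.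
  by move=> YS uY; apply: X_uniq; rewrite -memvE.
by rewrite -(XE V VS uV) -(XE W WS uW).
Qed.

(** A plane U of S' that is not in S is covered by the planes of S outside T,
of which there are at most two, W1 and W2.  Take u1 in U outside W1 and u2 in U
outside W2: then u1 + u2 is in neither. *)
Lemma spread_eq_of_two_missing (S S' T : {set {vspace 'rV[F]_6}}) :
    spread S -> spread S' -> T \subset S -> T \subset S' ->
  (#|S| <= #|T| + 2)%N -> S' = S.
Proof.
move=> S_spr S'_spr sTS sTS' le_S; apply/eqP; rewrite eqEcard.
have [cardS dimS _] := S_spr; have [cardS' dimS' _] := S'_spr.
rewrite cardS cardS' leqnn andbT; apply/subsetP=> U US'; apply: contraT => U_notS.
have cover u : u \in U -> u != 0 -> exists2 W, W \in S :\: T & u \in W.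
  move=> uU u_neq0; have [W WS uW] := spread_cover S_spr u_neq0.
  exists W => //; rewrite inE WS andbT; apply: contraNN U_notS => WT.
  by rewrite (spread_disjoint S'_spr u_neq0 US' (subsetP sTS' _ WT) uU uW).
have notin W : W \in S :\: T -> exists2 u, u \in U & u \notin W.
  case/setDP=> WS _; apply/subvPn; apply: contra U_notS => sUW.
  suff -> : U = W by [].
  by apply/eqP; rewrite eqEdim sUW dimS ?dimS'.
have neq0 (u : 'rV[F]_6) (W : {vspace 'rV[F]_6}) : u \notin W -> u != 0.
  by apply: contraNneq => ->; rewrite mem0v.
have [W1 W1S _] : exists2 W1, W1 \in S :\: T & vpick U \in W1.
  by apply: cover (memv_pick U) _; rewrite vpick0 -dimv_eq0 dimS'.
have [u1 u1U u1W1] := notin _ W1S.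
have [W2 W2S u1W2] := cover _ u1U (neq0 _ _ u1W1).
have neq_W : W1 != W2 by apply: contraNneq u1W1 => ->.
have [u2 u2U u2W2] := notin _ W2S.
have two W : W \in S :\: T -> W = W1 \/ W = W2.
  move=> WS; suff : W \in [set W1; W2] by rewrite !inE => /orP[]/eqP; [left|right].
  suff -> : [set W1; W2] = S :\: T by [].
  apply/eqP; rewrite eqEcard cards2 neq_W cardsD (setIidPr sTS).
  rewrite leq_subLR le_S andbT.
  by apply/subsetP=> X /set2P[]->.
have u2W1 : u2 \in W1.
  by have [W /two[]->] := cover _ u2U (neq0 _ _ u2W2); rewrite // (negPf u2W2).
have u12 : u1 + u2 \notin W1 by rewrite rpredDr.
have [W /two[]-> //] := cover _ (rpredD u1U u2U) (neq0 _ _ u12).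
  by rewrite (negPf u12).
by rewrite rpredDl // (negPf u2W2).
Qed.

(** Closure under lines gives closure under addition as soon as F has an
element c other than 0 and 1, because s + t lies on the line through
s / (1 - c) and t / c.  If an F-subspace W missed k, the sum of W and F k
would be direct and too large for K. *)
Lemma line_closed_full (W : {set K}) : (2 < #|F|)%N -> 0 \in W ->
  (forall s t c, s \in W -> t \in W -> s + iota c * (t - s) \in W) ->
  (#|F| ^ 2 < #|W|)%N -> W = setT.
Proof.
move=> F_gt2 W0 W_line W_big.
have WZ c t : t \in W -> iota c * t \in W.
  by move=> tW; have := W_line 0 t c W0 tW; rewrite add0r subr0.
have WD s t : s \in W -> t \in W -> s + t \in W.
  have [c /andP[c_neq0 c_neq1]] : exists c : F, (c != 0) && (c != 1).
    apply/existsP; apply: contraLR F_gt2 => /existsPn F01.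
    have F_sub : [set: F] \subset [set 0; 1].
      by apply/subsetP=> c _; have := F01 c; rewrite negb_and !negbK !inE.
    rewrite -leqNgt -cardsT (leq_trans (subset_leq_card F_sub)) // cards2.
    by rewrite ltnS leq_b1.
  have ic_neq0 : iota c != 0 by rewrite fmorph_eq0.
  have ic_neq1 : 1 - iota c != 0 by rewrite subr_eq0 eq_sym fmorph_eq1.
  move=> sW tW; have := W_line _ _ c (WZ (1 - c)^-1 _ sW) (WZ c^-1 _ tW).
  rewrite !fmorphV rmorphB rmorph1; congr (_ \in W).
  by field; rewrite ic_neq0 ic_neq1.
apply/eqP; rewrite -subTset; apply/subsetP=> k _; apply: contraT => k_notW.
have : (#|[set (p.1 + iota p.2 * k)%R | p in setX W [set: F]]| <= #|F| ^ 3)%N.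
  by rewrite -cardK max_card.
rewrite card_in_imset => [|[s c] [t d]].
  rewrite cardsX cardsT expnSr leq_pmul2r; last exact: ltnW (ltnW F_gt2).
  by rewrite leqNgt W_big.
rewrite !in_setX /= !inE !andbT => sW tW eq_k.
have [cd|neq_cd] := eqVneq c d; first by move: eq_k; rewrite cd => /addIr->.
have dc_neq0 : iota (d - c) != 0 by rewrite fmorph_eq0 subr_eq0 eq_sym.
case/negP: k_notW; rewrite (_ : k = iota (d - c)^-1 * (s + iota (-1) * t)).
  by rewrite WZ ?WD ?WZ.
apply: (mulfI dc_neq0).
rewrite mulrA -rmorphM divff -?(fmorph_eq0 iota) // rmorph1 mul1r.
rewrite rmorphN1 mulN1r rmorphB mulrBl; apply/eqP.
rewrite subr_eq addrAC -subr_eq opprK.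
by rewrite [_ * k + t]addrC eq_k.
Qed.

Variable E : 'M[K]_(6, 2).
Hypothesis theta_inj : injective (theta iota E).

Local Notation theta := (theta iota E).
Local Notation psi := (psi iota E).
Local Notation plane := (plane iota E).
Hypothesis dim_plane : forall v, v != 0 -> \dim (plane v) = 3%N.

Definition indep (v w : 'rV[K]_2) :=
  forall x y, x *: v + y *: w = 0 -> x = 0 /\ y = 0.

Lemma plane_neq v w : indep v w -> plane v != plane w.
Proof.
move=> vw; apply/eqP=> eq_vw.
have : psi v \in plane w by rewrite -eq_vw mem_plane psiK // memv_line.
rewrite mem_plane psiK // => /vlineP[k vE].
have [|/eqP] := vw 1 (- k); first by rewrite vE scale1r scaleNr subrr.
by rewrite oner_eq0.
Qed.

Lemma plane_uniq v w : indep v w -> uniq [:: plane v; plane w; plane (v + w)].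
Proof.
move=> vw; rewrite /= !inE negb_or !plane_neq //.
  move=> x y; rewrite scalerDr addrCA -scalerDl => /vw[-> x0].
  by rewrite addr0 in x0.
move=> x y; rewrite scalerDr addrA -scalerDl => /vw[xy y0].
by rewrite y0 addr0 in xy.
Qed.

(** For each x, the line through the points x v and x w of the planes of v and w
also meets that of v + w, so it meets U, in some point x (w + c v).  The scalar
c does not depend on x, since U contains the differences of these points for
x, 1 and x + 1, and no nonzero multiple of v. *)
Lemma regulus_plane (R : {set {vspace 'rV[F]_6}}) v w U : indep v w ->
    regulus R -> plane v \in R -> plane w \in R -> plane (v + w) \in R ->
  U \in R -> U != plane v -> exists c, U = plane (w + iota c *: v).
Proof.
move=> vw [_ dimR disjR transR] vR wR vwR UR U_neq.
have U_disj u y : u \in U -> theta u = y *: v -> y = 0.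
  move=> uU uE; have [u0|u_neq0] := eqVneq u 0.
    by have [|-> //] := vw y 0; rewrite -uE u0 theta0 scale0r addr0.
  case/negP: (disjR _ _ UR vR U_neq); apply/meetsP; exists u => //; split=> //.
  by rewrite mem_plane uE memvZ ?memv_line.
have uniqR := plane_uniq vw.
have meet_line x : x != 0 -> exists c, psi (x *: (w + iota c *: v)) \in U.
  move=> x_neq0; pose l := (<[psi (x *: v)]> + <[psi (x *: w)]>)%VS.
  have psi_neq0 y : y != 0 -> psi y != 0.
    by apply: contra_neq => y0; rewrite -(psiK cardK theta_inj y) y0 theta0.
  have xv_neq0 : x *: v != 0.
    apply: contra_neq x_neq0 => xv0.
    by have [|-> //] := vw x 0; rewrite xv0 scale0r addr0.
  have xw_neq0 : x *: w != 0.
    apply: contra_neq x_neq0 => xw0.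
    by have [|_ -> //] := vw 0 x; rewrite xw0 scale0r addr0.
  have xvw_neq0 : x *: (v + w) != 0.
    apply: contra_neq x_neq0; rewrite scalerDr => xvw0.
    by have [] := vw _ _ xvw0.
  have vl : psi (x *: v) \in l by rewrite (subvP (addvSl _ _)) ?memv_line.
  have wl : psi (x *: w) \in l by rewrite (subvP (addvSr _ _)) ?memv_line.
  have dim_l : \dim l = 2%N.
    rewrite dimv_disjoint_sum ?dim_vline ?psi_neq0 //.
    apply/eqP; rewrite -subv0; apply/subvP=> z /memv_capP[/vlineP[c ->] /vlineP[d]].
    move/(congr1 theta); rewrite !thetaZ !psiK // !scalerA => /eqP.
    rewrite -subr_eq0 -scaleNr => /eqP/vw[/eqP].
    rewrite mulf_eq0 (negPf x_neq0) orbF fmorph_eq0 => /eqP-> _.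
    by rewrite scale0r mem0v.
  have : meets l U.
    apply: (transR l _ _ _ dim_l vR wR vwR uniqR _ _ _ _ UR); apply/meetsP.
    - exists (psi (x *: v)); rewrite ?psi_neq0 //; split=> //.
      by rewrite mem_plane psiK // memvZ ?memv_line.
    - exists (psi (x *: w)); rewrite ?psi_neq0 //; split=> //.
      by rewrite mem_plane psiK // memvZ ?memv_line.
    exists (psi (x *: (v + w))); rewrite ?psi_neq0 //; split; last first.
      by rewrite mem_plane psiK // memvZ ?memv_line.
    rewrite (_ : psi _ = psi (x *: v) + psi (x *: w)) ?rpredD //.
    by apply: theta_inj; rewrite thetaD !psiK // scalerDr.
  case/meetsP=> z z_neq0 [/memv_addP[_ /vlineP[c ->] [_ /vlineP[d ->] zE]] zU].
  have d_neq0 : d != 0.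
    apply: contraNneq z_neq0 => d0; rewrite zE d0 scale0r addr0.
    have := U_disj z (iota c * x) zU; rewrite zE d0 scale0r addr0 thetaZ psiK //.
    rewrite scalerA => /(_ erefl)/eqP.
    rewrite mulf_eq0 (negPf x_neq0) orbF fmorph_eq0.
    by move/eqP->; rewrite scale0r.
  exists (c / d); rewrite (_ : psi _ = d^-1 *: z) ?memvZ //.
  apply: theta_inj.
  rewrite psiK // zE !(thetaZ, thetaD) !psiK // fmorph_div fmorphV.
  have id_neq0 : iota d != 0 by rewrite fmorph_eq0.
  rewrite !scalerDr !scalerA addrC; congr (_ *: _ + _ *: _); by field.
have [c cU] := meet_line 1 (oner_neq0 _).
exists c; apply/esym/eqP; rewrite eqEdim dimR // dim_plane ?andbT; last first.
  apply/eqP; rewrite addrC -[w]scale1r => /vw[_ /eqP].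
  by rewrite oner_eq0.
apply/subvP=> u; rewrite mem_plane => /vlineP[x uE].
have [x0|x_neq0] := eqVneq x 0.
  suff -> : u = 0 by rewrite mem0v.
  by apply: theta_inj; rewrite uE x0 scale0r theta0.
have [d dU] := meet_line x x_neq0.
suff cd : c = d.
  rewrite (_ : u = psi (x *: (w + iota d *: v))) //.
  by apply: theta_inj; rewrite psiK // uE cd.
(* For x in F the points for x and 1 suffice; otherwise x and 1 are independent
   over F, and the point for x + 1 is compared with their sum. *)
have [f /eqP xE | x_notF] := pickP (fun f => x == iota f).
  have := U_disj _ (x * (iota d - iota c)) (rpredB dU (memvZ f cU)).
  rewrite thetaB thetaZ !psiK // -xE => xdc; apply/eqP.
  rewrite -(inj_eq (fmorph_inj iota)) eq_sym -subr_eq0.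
  rewrite -(mulrI_eq0 _ (mulfI x_neq0)).
  by apply/eqP/xdc/rowP=> k; rewrite !mxE; ring.
have [|e eU] := meet_line (x + 1).
  apply: contraFneq (x_notF (- 1)) => x1; rewrite rmorphN1.
  by rewrite -addr_eq0 x1.
have := U_disj _ (x * iota d + iota c - (x + 1) * iota e)
                (rpredB (rpredD dU cU) eU).
rewrite thetaB thetaD !psiK // => eq_cde.
have {}eq_cde : x * (iota d - iota e) = iota e - iota c.
  apply/eqP; rewrite -subr_eq0; apply/eqP; rewrite -[RHS]eq_cde; first by ring.
  by apply/rowP=> k; rewrite !mxE; ring.
have [de|neq_de] := eqVneq d e.
  apply: (fmorph_inj iota); apply/eqP; rewrite eq_sym -subr_eq0 de -eq_cde de.
  by rewrite subrr mulr0.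
have de_neq0 : iota d - iota e != 0 by rewrite -rmorphB fmorph_eq0 subr_eq0.
have /negP[] := x_notF ((e - c) / (d - e)); rewrite fmorph_div !rmorphB.
by apply/eqP; rewrite -eq_cde mulfK.
Qed.

(** [regulus_plane] leaves only q + 1 candidates for the planes of the regulus,
which therefore contains all of them. *)
Lemma regular_closed (S : {set {vspace 'rV[F]_6}}) v w c : regular_spread S ->
    indep v w -> plane v \in S -> plane w \in S -> plane (v + w) \in S ->
  plane (w + iota c *: v) \in S.
Proof.
case=> _ S_reg vw vS wS vwS.
have uniqS := plane_uniq vw.
have [R [R_reg /subsetP sR /subsetP sRS]] := S_reg _ _ _ vS wS vwS uniqS.
have [cardR _ _ _] := R_reg.
pose R' := plane v |: [set plane (w + iota c *: v) | c : F].
have sRR' : R \subset R'.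
  apply/subsetP=> U UR; rewrite !inE; case: eqP => //= /eqP U_neq.
  have [|||d ->] := regulus_plane vw R_reg _ _ _ UR U_neq; last exact: imset_f.
  1-3: by apply: sR; rewrite !inE eqxx ?orbT.
have /eqP RR' : R == R'.
  rewrite eqEcard sRR' cardR cardsU1 addnC leq_add ?leq_b1 //.
  exact: leq_imset_card.
apply: sRS; rewrite RR' in_setU1.
by rewrite (imset_f (fun c => plane (w + iota c *: v))) ?orbT.
Qed.

Lemma indep_span v w u : indep v w -> exists x y, u = x *: v + y *: w.
Proof.
move=> vw; pose M : 'M_2 := \matrix_i (if i == 0 then v else w).
have mulM (c : 'rV_2) : c *m M = c 0 0 *: v + c 0 1 *: w.
  rewrite mulmx_sum_row !big_ord_recl big_ord0 addr0 !rowK /=.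
  by congr (_ + c 0 _ *: _); apply/val_inj.
have M_unit : M \in unitmx.
  rewrite -row_free_unit; apply/inj_row_free => c; rewrite mulM => /vw[c0 c1].
  apply/rowP=> -[[|[|//]] lti]; rewrite [RHS]mxE.
    by rewrite -[RHS]c0; congr (c 0 _); apply/val_inj.
  by rewrite -[RHS]c1; congr (c 0 _); apply/val_inj.
exists ((u *m invmx M) 0 0), ((u *m invmx M) 0 1).
by rewrite -mulM mulmxKV.
Qed.

(** Reguli through the plane of v0 correspond to F-lines in the affine line
formed by the other points of the projective line over K. *)
Lemma regular_full (S : {set {vspace 'rV[F]_6}}) (T : {set {vspace 'rV[F]_6}}) :
    (2 < #|F|)%N -> regular_spread S -> T \subset S ->
    (forall W, W \in T -> exists2 v, v != 0 & W = plane v) ->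
    (#|F| ^ 2 + 1 < #|T|)%N ->
  forall v, v != 0 -> plane v \in S.
Proof.
move=> F_gt2 S_reg /subsetP sTS T_planes T_big.
have /card_gt0P[W0 W0T] : (0 < #|T|)%N by apply: leq_ltn_trans T_big.
have [v0 v0_neq0 W0E] := T_planes _ W0T.
have /card_gt0P[W1 /setD1P[W1_neq W1T]] : (0 < #|T :\ W0|)%N.
  by move: T_big; rewrite (cardsD1 W0) W0T add1n addn1 ltnS; apply: leq_ltn_trans.
have [v1 v1_neq0 W1E] := T_planes _ W1T.
have v01 : indep v0 v1.
  move=> x y xy0; have y0 : y = 0.
    apply/eqP; apply: contraNT W1_neq => y_neq0.
    have v1E : v1 = (- (x / y)) *: v0.
      apply: (scalerI y_neq0); rewrite scalerA mulrN mulrCA divff // mulr1 scaleNr.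
      by apply/eqP; rewrite -addr_eq0 addrC xy0.
    rewrite W1E W0E v1E planeZ //; apply: contraNneq v1_neq0 => xy.
    by rewrite v1E xy scale0r.
  split=> //; apply/eqP; move/eqP: xy0.
  by rewrite y0 scale0r addr0 scaler_eq0 (negPf v0_neq0) orbF.
have planeE v : v != 0 ->
    plane v = plane v0 \/ exists t, plane v = plane (v1 + t *: v0).
  move=> v_neq0; have [x [y vE]] := indep_span v v01.
  have [y0|y_neq0] := eqVneq y 0.
    left; rewrite vE y0 scale0r addr0 planeZ //; apply: contraNneq v_neq0 => x0.
    by rewrite vE x0 y0 !scale0r addr0.
  right; exists (y^-1 * x).
  rewrite -[RHS](planeZ iota E (v1 + (y^-1 * x) *: v0) y_neq0); congr plane.
  by rewrite vE scalerDr scalerA mulrA divff // mul1r addrC.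
pose X := [set t | plane (v1 + t *: v0) \in S].
have XT : X = setT.
  apply: line_closed_full F_gt2 _ _ _.
  - by rewrite inE scale0r addr0 -W1E sTS.
  - move=> s t c; rewrite !inE => sX tX.
    have [->|neq_st] := eqVneq s t; first by rewrite subrr mulr0 addr0.
    have ts_neq0 : t - s != 0 by rewrite subr_eq0 eq_sym.
    rewrite (_ : v1 + _ = v1 + s *: v0 + iota c *: ((t - s) *: v0)); last first.
      by rewrite scalerDl addrA scalerA.
    apply: regular_closed => //.
    + move=> x y xy0; have [|xts y0] := v01 (x * (t - s) + y * s) y.
        by rewrite -[RHS]xy0; apply/rowP=> k; rewrite !mxE; ring.
      split=> //; apply/eqP; move/eqP: xts.
      by rewrite y0 mul0r addr0 mulf_eq0 (negPf ts_neq0) orbF.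
    + by rewrite planeZ // -W0E sTS.
    by rewrite addrCA -scalerDl subrK.
  have : (#|T| <= #|plane v0 |: [set plane (v1 + t *: v0) | t in X]|)%N.
    apply/subset_leq_card/subsetP=> W WT; have [v v_neq0 WE] := T_planes _ WT.
    rewrite in_setU1 WE; have [->|[t tE]] := planeE v v_neq0; first by rewrite eqxx.
    apply/orP; right; apply/imsetP; exists t => //.
    by rewrite inE -tE -WE sTS.
  move/(leq_trans T_big); rewrite cardsU1 addn1 -[_.+2]add1n => /leq_trans le_q.
  have := le_q _ (leq_add (leq_b1 _) (leq_imset_card _ _)).
  by rewrite leq_add2l.
move=> v /planeE[->|[t ->]]; first by rewrite -W0E sTS.
have : t \in X by rewrite XT inE.
by rewrite inE.
Qed.

End Uniqueness.

(** * The size of a splash *)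

Section SplashCard.
Variables (F K : finFieldType) (iota : {rmorphism F -> K}).
Variables (a : 'rV[K]_3) (U : 'M[K]_(3, 2)).
Hypothesis a_free : forall f : 'rV[F]_3, map_mx iota f *m a^T = 0 -> f = 0.
Hypothesis kerU : forall r : 'rV[K]_3, r *m U = 0 <-> (r <= a)%MS.

(** If f U and h U are proportional, some combination of f and h over K is a
multiple m a.  The rational vector f x h is orthogonal to f and h, so it is
orthogonal to a if m != 0, and then it vanishes by the independence of the
coordinates of a; if m = 0, it vanishes because f and h are proportional. *)
Lemma splash_vec_inj (f h : 'rV[F]_3) : h != 0 ->
  splash_vec iota U f \in <[splash_vec iota U h]>%VS -> exists c, f = c *: h.
Proof.
move=> h_neq0 /vlineP[k /eqP]; rewrite -subr_eq0 scalemxAl -mulmxBl.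
move/eqP/kerU/sub_rVP=> [m fhE].
have [fh0|fh_neq0] := eqVneq (f *m cross h) 0.
  exact: proportional_of_cross fh0.
pose g := f *m cross h.
have fE : map_mx iota f = k *: map_mx iota h.
  apply/eqP; rewrite -subr_eq0 fhE; apply: contraNT fh_neq0 => ma_neq0.
  have m_neq0 : m != 0 by apply: contraNneq ma_neq0 => ->; rewrite scale0r.
  apply/eqP/a_free/(scalerI m_neq0).
  rewrite scaler0 scalemxAr -linearZ /= -fhE linearB linearZ /=.
  rewrite mulmxBr -scalemxAr !map_trmx -!map_mxM cross_orthol cross_orthor.
  by rewrite map_mx0 scaler0 subrr.
case/negP: fh_neq0; apply/eqP/rowP=> j; rewrite crossE [RHS]mxE.
apply: (fmorph_inj iota); rewrite rmorph0 rmorphB !rmorphM.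
have fi i : iota (f 0 i) = k * iota (h 0 i) by have /rowP/(_ i) := fE; rewrite !mxE.
by rewrite !fi; ring.
Qed.

(** The q^3 - 1 nonzero vectors f are nonzero multiples of one representative
for each plane. *)
Lemma card_splash (E : 'M[K]_(6, 2)) (T : {set {vspace 'rV[F]_6}}) :
    #|K| = (#|F| ^ 3)%N -> injective (theta iota E) ->
    (forall f, f != 0 -> plane iota E (splash_vec iota U f) \in T) ->
  (#|F| ^ 2 + #|F| + 1 <= #|T|)%N.
Proof.
move=> cardK theta_inj fT.
pose P f := plane iota E (splash_vec iota U f).
pose rep W := odflt 0 [pick f | (f != 0) && (P f == W)].
have F_gt1 := card_finNzRing_gt1 F.
have : [set~ (0 : 'rV[F]_3)] \subset
    [set (p.1 *: rep p.2)%R | p in setX [set~ (0 : F)] T].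
  apply/subsetP=> f; rewrite !inE => f_neq0; apply/imsetP.
  have [h_neq0 Ph] : rep (P f) != 0 /\ P (rep (P f)) = P f.
    rewrite /rep; case: pickP => [h /andP[? /eqP] // | /(_ f)].
    by rewrite f_neq0 eqxx.
  have [|c fE] := @splash_vec_inj f _ h_neq0.
    rewrite -(psiK cardK theta_inj (splash_vec iota U f)) -mem_plane -/(P _) Ph.
    by rewrite mem_plane psiK // memv_line.
  exists (c, P f) => //=; rewrite in_setX !inE fT // andbT.
  by apply: contraNneq f_neq0 => c0; rewrite fE c0 scale0r.
move/subset_leq_card/leq_trans/(_ (leq_imset_card _ _)).
rewrite cardsX !cardsC1 card_mx mul1n.
rewrite predn_exp leq_pmul2l ?ltn_predRL //.
rewrite !big_ord_recr big_ord0 /= add0n expn0 expn1.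
by rewrite addnC [(1 + _)%N]addnC addnA.
Qed.

End SplashCard.

Theorem lemma6p1 (q : nat) (F K : finFieldType) (iota : {rmorphism F -> K})
    (cardF : #|F| = q) (cardK : #|K| = (q ^ 3)%N)
    (tau : K) (tau_prim : (q ^ 3 - 1).-primitive_root tau)
    (S SS : {set {vspace 'rV[F]_6}})
    (S_regular : regular_spread S)
    (SS_splash : exterior_splash iota tau S SS) :
  [/\ #|transversals iota SS| = 3%N,
      transversals iota SS = transversals iota S
    & forall S' : {set {vspace 'rV[F]_6}},
        (regular_spread S' /\ SS \subset S') <-> S' = S].
Proof.
subst q; have tau_notin := @primitive_notin _ _ iota _ tau_prim.
have [E [a [U [theta_inj SE a_free kerU [sSS SS_vec]]]]] :=
  exterior_splashP cardK tau_notin SS_splash.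
have [S_spread _] := S_regular; have [cardS dimS _] := S_spread.
have planeS v : v != 0 -> plane iota E v \in S by move=> ?; apply/SE; exists v.
have dim_plane v : v != 0 -> \dim (plane iota E v) = 3%N by move/planeS/dimS.
have SS_big := card_splash a_free kerU cardK theta_inj SS_vec.
pose lines := [set conj_line iota tau E i | i : 'I_3].
have sub_linesS : lines \subset transversals iota S.
  apply/subsetP=> _ /imsetP[i _ ->]; rewrite inE dim_conj_line // eqxx /=.
  by apply/forall_inP=> W /SE[v v_neq0 ->]; apply: conj_line_meets.
have sub_SSS : transversals iota S \subset transversals iota SS.
  apply/subsetP=> l; rewrite !inE => /andP[-> /forall_inP l_meets].
  by apply/forall_inP=> W /(subsetP sSS)/l_meets.
have sub_SSlines : transversals iota SS \subset lines.
  apply/subsetP=> l; rewrite inE => /andP[/eqP dim_l /forall_inP l_meets].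
  have [f f_neq0|i ->] :=
    splash_transversal cardK tau_notin a_free kerU theta_inj dim_l.
    exact/l_meets/SS_vec.
  exact: imset_f.
have SSE : transversals iota SS = transversals iota S.
  apply/eqP; rewrite eqEsubset sub_SSS andbT.
  exact: subset_trans sub_SSlines sub_linesS.
split=> //.
  have -> : transversals iota SS = lines.
    by apply/eqP; rewrite eqEsubset sub_SSlines SSE.
  by rewrite card_imset ?card_ord //; apply: conj_line_inj.
move=> S'; split=> [[S'_regular sSS']|-> //].
have [S'_spread _] := S'_regular; have [cardS' _ _] := S'_spread.
have [F_gt2 | F_le2] := ltnP 2 #|F|.
  apply/eqP; rewrite eq_sym eqEcard cardS cardS' leqnn andbT.
  apply/subsetP=> W /SE[v v_neq0 ->].
  apply: (regular_full cardK theta_inj dim_plane F_gt2 S'_regular sSS') => //.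
    by move=> X /(subsetP sSS)/SE.
  apply: leq_trans SS_big; rewrite -addSn leq_add2r.
  by rewrite -addn1 leq_add2l ltnW // card_finNzRing_gt1.
apply: (spread_eq_of_two_missing S_spread S'_spread sSS sSS').
have F2 : #|F| = 2%N by apply/eqP; rewrite eqn_leq F_le2 card_finNzRing_gt1.
by rewrite cardS F2 in SS_big *; rewrite -(leq_add2r 2) in SS_big.
Qed.
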